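(* Let $X$ be a locally compact Hausdorff space with a Borel measure $\mu$ such that $0<\mu(X)<\infty$ and such that the only class $[f]\in\mathbb{TP}(X)$ with $f$ $\mu$-a.e. equal to a constant is the class of constants. For each lower (respectively upper) tropically convex set $W\subseteq\mathbb{TP}(X)$ and each compact lower (respectively upper) tropically convex subset $T$ of $W$, there exists a lower (respectively upper) tropical retraction of $W$ onto $T$, i.e. a strong deformation retraction $h:[0,1]\times W\to W$ of $W$ onto $T$ such that for every $t\in[0,1]$ the set $h(t,W)$ is lower (respectively upper) tropically convex.
   Context: $BC(X)$: bounded continuous real functions on $X$; $\mathbb{TP}(X)=BC(X)/(\text{constants})$, $[f]$ the class of $f$, with the metric $\rho([f],[g])=\sup(g-f)-\inf(g-f)$ and its topology. $\underline{f}=f-\inf f$, $\overline{f}=f-\sup f$. For $\alpha=[f],\beta=[g]$, $d=\rho(\alpha,\beta)$: lower tropical segment $\underline{[\alpha,\beta]}=\{[\min(t,\underline{g-f})+f]:t\in[0,d]\}$, upper tropical segment $\overline{[\alpha,\beta]}=\{[\max(-t,\overline{g-f})+f]:t\in[0,d]\}$. A subset is lower (resp. upper) tropically convex if it contains the lower (resp. upper) tropical segment between any two of its points. A strong deformation retraction of $W$ onto $T$ is a continuous $h:[0,1]\times W\to W$ with $h(0,x)=x$ for all $x\in W$, $h(1,W)=T$, and $h(t,x)=x$ for all $t$ and all $x\in T$. *)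

(* Defs.v *)
From HB Require Import structures.
From mathcomp Require Import all_boot all_order all_algebra ring_quotient.
From mathcomp Require Import all_classical all_reals all_analysis.
From mathcomp Require Import lra.
Set Implicit Arguments.
Unset Strict Implicit.
Unset Printing Implicit Defensive.
Import Order.TTheory GRing.Theory Num.Theory.
Import numFieldNormedType.Exports.
Local Open Scope classical_set_scope.
Local Open Scope ring_scope.
Local Open Scope quotient_scope.

Definition bcont (X : topologicalType) (R : realType) : {pred X -> R} :=
  [pred f : X -> R | `[< continuous f /\ bounded_fun (f : X -> R^o) >]].

Arguments bcont : clear implicits.

Section BC.
Context {X : topologicalType} {R : realType}.

Lemma bcontP (f : X -> R) :
  f \in bcont X R <-> continuous f /\ exists M, forall x, `|f x| <= M.
Proof.
split=> [/asboolP[cf /pinfty_ex_gt0[M _ hM]]|[cf [M hM]]].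
  by split=> //; exists M => x; apply: hM.
apply/asboolP; split=> //; exists M; split; first exact: num_real.
move=> N MN x _; have hN : `|f x| <= N by rewrite (le_trans (hM x))// ltW.
exact: hN.
Qed.

Fact bcont_zmod_closed : zmod_closed (bcont X R).
Proof.
split.
  apply/bcontP; split; first exact: cst_continuous.
  by exists 0 => x; rewrite normr0.
move=> f g /bcontP[cf [M hM]] /bcontP[cg [N hN]]; apply/bcontP; split.
  by move=> x; apply: (@continuousB R R^o X f g); [exact: cf|exact: cg].
by exists (M + N) => x; rewrite (le_trans (ler_normB _ _))// lerD.
Qed.

HB.instance Definition _ :=
  GRing.isZmodClosed.Build (X -> R) (bcont X R) bcont_zmod_closed.

End BC.

Record BC (X : topologicalType) (R : realType) := MkBC {
  bc_fun :> X -> R ;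
  _ : bc_fun \in bcont X R }.

HB.instance Definition _ X R := [isSub for @bc_fun X R].
HB.instance Definition _ X R := [Choice of BC X R by <:].
HB.instance Definition _ X R := [SubChoice_isSubZmodule of BC X R by <:].

Section BCops.
Context {X : topologicalType} {R : realType}.
Implicit Types (f g : BC X R) (c : R).

Lemma bc_cont f : continuous f.
Proof. by have /bcontP[] := valP f. Qed.

Lemma bc_bounded f : exists M, forall x, `|f x| <= M.
Proof. by have /bcontP[] := valP f. Qed.

Lemma bc_ext f g : f =1 g -> f = g.
Proof. by move=> fg; apply/val_inj/funext. Qed.

Lemma bcDE f g x : (f + g) x = f x + g x. Proof. by []. Qed.
Lemma bcBE f g x : (f - g) x = f x - g x. Proof. by []. Qed.
Lemma bcNE f x : (- f) x = - f x. Proof. by []. Qed.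
Lemma bc0E x : (0 : BC X R) x = 0. Proof. by []. Qed.

Fact bc_cst_proof c : (fun=> c) \in bcont X R.
Proof.
by apply/bcontP; split; [exact: cst_continuous|exists `|c| => x; exact: lexx].
Qed.
Definition bc_cst c : BC X R := MkBC (bc_cst_proof c).

Fact bc_min_proof f g : (fun x => Num.min (f x) (g x)) \in bcont X R.
Proof.
apply/bcontP; split.
  by move=> x; apply: (@continuous_min R X f g); exact: bc_cont.
have [M hM] := bc_bounded f; have [N hN] := bc_bounded g.
exists (Num.max M N) => x; rewrite le_max minEle.
by case: ifP => _; rewrite ?hM ?hN ?orbT.
Qed.
Definition bc_min f g : BC X R := MkBC (bc_min_proof f g).

Fact bc_max_proof f g : (fun x => Num.max (f x) (g x)) \in bcont X R.
Proof.
apply/bcontP; split.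
  by move=> x; apply: (@continuous_max R X f g); exact: bc_cont.
have [M hM] := bc_bounded f; have [N hN] := bc_bounded g.
exists (Num.max M N) => x; rewrite le_max [X in `|X|]maxEle.
by case: ifP => _; rewrite ?hM ?hN ?orbT.
Qed.
Definition bc_max f g : BC X R := MkBC (bc_max_proof f g).

Definition bc_inf f : R := inf (range f).
Definition bc_sup f : R := sup (range f).

Definition bc_lower f : BC X R := f - bc_cst (bc_inf f).
Definition bc_upper f : BC X R := f - bc_cst (bc_sup f).

Definition bc_constant : {pred BC X R} :=
  [pred f | `[< exists c, f = bc_cst c >]].

Lemma bc_constantP f : f \in bc_constant <-> exists c, f = bc_cst c.
Proof. by split=> [/asboolP|?]//; apply/asboolP. Qed.

Fact bc_constant_zmod_closed : zmod_closed bc_constant.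
Proof.
split; first by apply/bc_constantP; exists 0; exact: bc_ext.
move=> f g /bc_constantP[c ->] /bc_constantP[d ->]; apply/bc_constantP.
by exists (c - d); exact: bc_ext.
Qed.

HB.instance Definition _ :=
  GRing.isZmodClosed.Build (BC X R) bc_constant bc_constant_zmod_closed.

End BCops.

Arguments bc_constant : clear implicits.

(* TP(X) = BC(X) / constants, as a quotient group; 0 is the class of constants
   (TPclass_cst). *)
Definition TP (X : topologicalType) (R : realType) : Type :=
  Quotient.quot (bc_constant X R).

HB.instance Definition _ X R := GRing.Zmodule.on (TP X R).

Definition TPclass (X : topologicalType) (R : realType) (f : BC X R) : TP X R :=
  \pi_(Quotient.quot (bc_constant X R)) f.

Definition TPrepr (X : topologicalType) (R : realType) (a : TP X R) : BC X R :=
  repr (a : Quotient.quot (bc_constant X R)).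

Section TPmetric.
Context {X : topologicalType} {R : realType}.
Implicit Types (f g h : BC X R) (a b : TP X R).

Lemma TPreprK a : TPclass (TPrepr a) = a.
Proof. exact: reprK. Qed.

Lemma TPclass_eqP f g : TPclass f = TPclass g <-> exists c, f = g + bc_cst c.
Proof.
have -> : (TPclass f = TPclass g) <-> f - g \in bc_constant X R.
  by rewrite Quotient.idealrBE; split=> [|/eqP]; [move=> e; apply/eqP|].
split=> [/bc_constantP[c fgc]|[c ->]]; last first.
  by apply/bc_constantP; exists c; rewrite addrAC subrr add0r.
by exists c; rewrite -fgc addrC subrK.
Qed.

Lemma TPclass_cst (c : R) : TPclass (bc_cst c : BC X R) = 0.
Proof.
have -> : 0 = TPclass (0 : BC X R) by rewrite /TPclass pi_zeror.
by apply/TPclass_eqP; exists c; rewrite add0r.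
Qed.

(* Computed on chosen representatives; TPdistE gives it on arbitrary ones. *)
Definition TPdist a b : R :=
  bc_sup (TPrepr b - TPrepr a) - bc_inf (TPrepr b - TPrepr a).

Lemma bc_has_sup f (x : X) : has_sup (range f).
Proof.
split; first by exists (f x), x.
have [M hM] := bc_bounded f; exists M => _ [y _ <-].
exact: le_trans (ler_norm _) (hM y).
Qed.

Lemma bc_has_inf f (x : X) : has_inf (range f).
Proof.
split; first by exists (f x), x.
have [M hM] := bc_bounded f; exists (- M) => _ [y _ <-].
by have := hM y; rewrite ler_norml => /andP[].
Qed.

Lemma bc_le_sup f x : f x <= bc_sup f.
Proof. by apply: sup_upper_bound; [exact: bc_has_sup x|exists x]. Qed.

Lemma bc_ge_inf f x : bc_inf f <= f x.
Proof. by apply: ge_inf; [exact: (bc_has_inf f x).2|exists x]. Qed.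

Lemma bc_sup_le f (x : X) (M : R) : (forall y, f y <= M) -> bc_sup f <= M.
Proof. by move=> fM; apply: ge_sup => [|_ [y _ <-]]; [exists (f x), x|]. Qed.

Lemma bc_inf_ge f (x : X) (M : R) : (forall y, M <= f y) -> M <= bc_inf f.
Proof. by move=> fM; apply: lb_le_inf => [|_ [y _ <-]]; [exists (f x), x|]. Qed.

Lemma bc_supD f (c : R) (x : X) : bc_sup (f + bc_cst c) = bc_sup f + c.
Proof.
apply/eqP; rewrite eq_le; apply/andP; split.
  by apply: bc_sup_le => // y; rewrite bcDE lerD2r bc_le_sup.
rewrite -lerBrDr; apply: bc_sup_le => // y; rewrite lerBrDr.
exact: (bc_le_sup (f + bc_cst c) y).
Qed.

Lemma bc_infD f (c : R) (x : X) : bc_inf (f + bc_cst c) = bc_inf f + c.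
Proof.
apply/eqP; rewrite eq_le; apply/andP; split; last first.
  by apply: bc_inf_ge => // y; rewrite bcDE lerD2r bc_ge_inf.
rewrite -lerBlDr; apply: bc_inf_ge => // y; rewrite lerBlDr.
exact: (bc_ge_inf (f + bc_cst c) y).
Qed.

Lemma TPclass_reprP f : exists c, TPrepr (TPclass f) = f + bc_cst c.
Proof. by apply/TPclass_eqP; rewrite TPreprK. Qed.

Lemma bc_emptyE f g : (X -> False) -> f = g.
Proof. by move=> X0; apply: bc_ext => x; case: (X0 x). Qed.

Lemma empty_or_point : (X -> False) \/ exists x : X, True.
Proof.
have [[x _]|nX] := pselect (exists x : X, True); first by right; exists x.
by left=> x; apply: nX; exists x.
Qed.

Lemma TPdistE f g :
  TPdist (TPclass f) (TPclass g) = bc_sup (g - f) - bc_inf (g - f).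
Proof.
case: empty_or_point => [X0|[x _]].
  by rewrite /TPdist (bc_emptyE (_ - _) (g - f) X0).
rewrite /TPdist; have [c ->] := TPclass_reprP f; have [d ->] := TPclass_reprP g.
have -> : g + bc_cst d - (f + bc_cst c) = g - f + bc_cst (d - c).
  by apply: bc_ext => y; rewrite !(bcDE, bcNE)/=; lra.
by rewrite bc_supD// bc_infD//; lra.
Qed.

Fact TPdistxx a : TPdist a a = 0.
Proof.
rewrite /TPdist subrr; case: empty_or_point => [X0|[x _]].
  have -> : bc_inf (0 : BC X R) = bc_sup (0 : BC X R); last exact: subrr.
  have r0 : range (0 : BC X R) = set0.
    by rewrite -subset0 => z [y]; case: (X0 y).
  by rewrite /bc_inf /bc_sup r0 inf0 sup0.
apply/eqP; rewrite subr_eq0 eq_le; apply/andP; split.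
  by apply: bc_sup_le => // y; apply: bc_inf_ge => // z.
exact: le_trans (bc_ge_inf _ x) (bc_le_sup _ x).
Qed.

Fact TPdist_positivity a b : TPdist a b = 0 -> a = b.
Proof.
rewrite -(TPreprK a) -(TPreprK b); move: (TPrepr a) (TPrepr b) => f g.
rewrite TPdistE => /eqP; rewrite subr_eq0 => /eqP e.
apply/TPclass_eqP; exists (- bc_sup (g - f)); apply: bc_ext => x.
have := bc_le_sup (g - f) x; have := bc_ge_inf (g - f) x.
by rewrite e !(bcDE, bcNE)/=; lra.
Qed.

Fact TPdist_sym a b : TPdist a b = TPdist b a.
Proof.
rewrite /TPdist; move: (TPrepr a) (TPrepr b) => f g.
suff le h k : bc_sup (h - k) - bc_inf (h - k) <= bc_sup (k - h) - bc_inf (k - h).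
  by apply/eqP; rewrite eq_le !le.
case: empty_or_point => [X0|[x _]]; first by rewrite (bc_emptyE (h - k) (k - h) X0).
have s : bc_sup (h - k) <= - bc_inf (k - h).
  apply: bc_sup_le => // y; have := bc_ge_inf (k - h) y.
  by rewrite !(bcDE, bcNE); lra.
have i : - bc_sup (k - h) <= bc_inf (h - k).
  apply: bc_inf_ge => // y; have := bc_le_sup (k - h) y.
  by rewrite !(bcDE, bcNE); lra.
by move: s i; lra.
Qed.

Fact TPdist_triangle b a c : TPdist a c <= TPdist a b + TPdist b c.
Proof.
case: empty_or_point => [X0|[x _]].
  have E d e : d = e :> TP X R.
    by rewrite -(TPreprK d) (bc_emptyE (TPrepr d) (TPrepr e) X0) TPreprK.
  by rewrite (E a b) (E c b) TPdistxx addr0.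
rewrite /TPdist; move: (TPrepr a) (TPrepr b) (TPrepr c) => f g h.
have s : bc_sup (h - f) <= bc_sup (g - f) + bc_sup (h - g).
  apply: bc_sup_le => // y; have := bc_le_sup (g - f) y.
  by have := bc_le_sup (h - g) y; rewrite !(bcDE, bcNE); lra.
have i : bc_inf (g - f) + bc_inf (h - g) <= bc_inf (h - f).
  apply: bc_inf_ge => // y; have := bc_ge_inf (g - f) y.
  by have := bc_ge_inf (h - g) y; rewrite !(bcDE, bcNE); lra.
by move: s i; lra.
Qed.

HB.instance Definition _ := isMetric.Build R (TP X R)
  TPdistxx TPdist_positivity TPdist_sym TPdist_triangle.

Lemma mdist_TPclass f g :
  mdist (TPclass f) (TPclass g) = bc_sup (g - f) - bc_inf (g - f).
Proof. exact: TPdistE. Qed.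

(* The segments do not depend on the representatives: see lower_segmentE and
   upper_segmentE. *)
Definition lower_segment a b : set (TP X R) :=
  let f := TPrepr a in let g := TPrepr b in
  [set TPclass (bc_min (bc_cst t) (bc_lower (g - f)) + f)
    | t in `[0, mdist a b]].

Definition upper_segment a b : set (TP X R) :=
  let f := TPrepr a in let g := TPrepr b in
  [set TPclass (bc_max (bc_cst (- t)) (bc_upper (g - f)) + f)
    | t in `[0, mdist a b]].

Lemma lower_segmentE f g :
  lower_segment (TPclass f) (TPclass g) =
  [set TPclass (bc_min (bc_cst t) (bc_lower (g - f)) + f)
    | t in `[0, mdist (TPclass f) (TPclass g)]].
Proof.
rewrite /lower_segment; apply: eq_imagel => t _; apply/TPclass_eqP.
case: empty_or_point => [X0|[x _]]; first by exists 0; exact: bc_emptyE.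
have [c ->] := TPclass_reprP f; have [d ->] := TPclass_reprP g; exists c.
have -> : g + bc_cst d - (f + bc_cst c) = g - f + bc_cst (d - c).
  by apply: bc_ext => y; rewrite !(bcDE, bcNE)/=; lra.
rewrite addrA; congr (bc_min _ _ + _ + _); apply: bc_ext => y.
by rewrite !(bcDE, bcNE)/= bc_infD//; lra.
Qed.

Lemma upper_segmentE f g :
  upper_segment (TPclass f) (TPclass g) =
  [set TPclass (bc_max (bc_cst (- t)) (bc_upper (g - f)) + f)
    | t in `[0, mdist (TPclass f) (TPclass g)]].
Proof.
rewrite /upper_segment; apply: eq_imagel => t _; apply/TPclass_eqP.
case: empty_or_point => [X0|[x _]]; first by exists 0; exact: bc_emptyE.
have [c ->] := TPclass_reprP f; have [d ->] := TPclass_reprP g; exists c.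
have -> : g + bc_cst d - (f + bc_cst c) = g - f + bc_cst (d - c).
  by apply: bc_ext => y; rewrite !(bcDE, bcNE)/=; lra.
rewrite addrA; congr (bc_max _ _ + _ + _); apply: bc_ext => y.
by rewrite !(bcDE, bcNE)/= bc_supD//; lra.
Qed.

Definition lower_tropically_convex (W : set (TP X R)) :=
  forall a b, W a -> W b -> lower_segment a b `<=` W.

Definition upper_tropically_convex (W : set (TP X R)) :=
  forall a b, W a -> W b -> upper_segment a b `<=` W.

End TPmetric.

(* h is only constrained on [0, 1] x W, with the subspace topology. *)
Definition strong_deformation_retraction (R : realType) (Y : topologicalType)
    (W T : set Y) (h : R * Y -> Y) : Prop :=
  [/\ {within `[0, 1] `*` W, continuous h},
      forall t x, t \in `[0, 1] -> W x -> W (h (t, x)),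
      forall x, W x -> h (0, x) = x,
      [set h (1, x) | x in W] = T
    & forall t x, t \in `[0, 1] -> T x -> h (t, x) = x].

Definition lower_tropical_retraction (R : realType) (X : topologicalType)
    (W T : set (TP X R)) (h : R * TP X R -> TP X R) : Prop :=
  strong_deformation_retraction W T h /\
  forall t : R, t \in `[0, 1] -> lower_tropically_convex [set h (t, x) | x in W].

Definition upper_tropical_retraction (R : realType) (X : topologicalType)
    (W T : set (TP X R)) (h : R * TP X R -> TP X R) : Prop :=
  strong_deformation_retraction W T h /\
  forall t : R, t \in `[0, 1] -> upper_tropically_convex [set h (t, x) | x in W].

(* The library only provides generated sigma-algebras on pointed types. *)
Definition borelType (X : ptopologicalType) := g_sigma_algebraType (@open X).

(* Main.v *)
(* Lift subsets of TP(X) to BC(X): W is lower tropically convex iff its lift is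
   closed under minimum. If T is compact and lower tropically convex then every
   f has a least p(f) >= f in the lift of T. Moving f upwards to p(f) along
   min(f + c, p(f)) leaves p unchanged, and retracts W onto the sublevel sets
   of gap(f) = sup(p(f) - f), which are again closed under minimum. Letting the
   level decrease from +oo to 0 (as 1/t - 1) gives the retraction. The upper
   case is the lower one conjugated by negation. *)
Require Import Defs.
From HB Require Import structures.
From mathcomp Require Import all_boot all_order all_algebra.
From mathcomp Require Import all_classical all_reals all_analysis.
From mathcomp Require Import lra.
Set Implicit Arguments.
Unset Strict Implicit.
Unset Printing Implicit Defensive.
Import Order.TTheory GRing.Theory Num.Theory.
Import numFieldNormedType.Exports.
Local Open Scope classical_set_scope.
Local Open Scope ring_scope.

(** * Pointwise evaluation of the operations on bounded continuous functions *)

Section Pointwise.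
Context {R : realType} {X : topologicalType}.
Implicit Types (f g : BC X R) (c : R) (x : X).

Lemma bcminE f g x : bc_min f g x = Num.min (f x) (g x). Proof. by []. Qed.
Lemma bcmaxE f g x : bc_max f g x = Num.max (f x) (g x). Proof. by []. Qed.
Lemma bccstE c x : (bc_cst c : BC X R) x = c. Proof. by []. Qed.
Lemma bclowerE f x : bc_lower f x = f x - bc_inf f. Proof. by []. Qed.
Definition bcE := (@bcDE X R, @bcBE X R, @bcNE X R, bccstE, bclowerE).

End Pointwise.

(** * Lifts of lower tropically convex sets, and least elements above a function *)

Section MinClosed.
Context {R : realType} {X : ptopologicalType}.
Implicit Types (f g q r : BC X R) (W T : set (TP X R)) (c e : R).

Lemma TPclassD f c : TPclass (f + bc_cst c) = TPclass f.
Proof. by apply/TPclass_eqP; exists c. Qed.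

Lemma mdist_TPclass_le f g m e :
  (forall x, m <= g x - f x <= m + e) -> mdist (TPclass f) (TPclass g) <= e.
Proof.
move=> fg; rewrite mdist_TPclass.
have : bc_sup (g - f) <= m + e.
  by apply: bc_sup_le => [|x]; [exact: point|have /andP[] := fg x].
have : m <= bc_inf (g - f).
  by apply: bc_inf_ge => [|x]; [exact: point|have /andP[] := fg x].
lra.
Qed.

(** Shifting [g] by [- bc_inf (g - f)] brings the difference into [0, d]. Later proofs use the
    metric in this pointwise form. *)
Lemma mdist_TPclass_repr f g :
  exists c, forall x, f x <= g x + c <= f x + mdist (TPclass f) (TPclass g).
Proof.
exists (- bc_inf (g - f)) => x; rewrite mdist_TPclass.
have := bc_ge_inf (g - f) x; have := bc_le_sup (g - f) x.
by rewrite bcBE; lra.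
Qed.

(** A segment point is the class of a minimum of shifts of [f] and [g], and shifts do not change
    classes. Conversely, [bc_min f g] represents the segment point of parameter
    [- bc_inf (g - f)]. *)
Lemma lower_tropically_convexP W :
  lower_tropically_convex W <->
  forall f g, W (TPclass f) -> W (TPclass g) -> W (TPclass (bc_min f g)).
Proof.
split=> [cW f g Wf Wg|mW a b Wa Wb _ [t _ <-]]; last first.
  set f := TPrepr a; set g := TPrepr b.
  have -> : bc_min (bc_cst t) (bc_lower (g - f)) + f =
      bc_min (f + bc_cst t) (g + bc_cst (- bc_inf (g - f))).
    apply: bc_ext => x; rewrite bcDE !bcminE addr_minl !bcE.
    by congr Num.min; lra.
  by apply: mW; rewrite TPclassD TPreprK.
(* The parameter lies in [0, d] only when [bc_inf (g - f) <= 0 <= bc_sup (g - f)]; otherwise [f] and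
   [g] are comparable and their minimum is one of them. *)
have [i0|i0] := ltP 0 (bc_inf (g - f)).
  suff -> : bc_min f g = f by [].
  apply: bc_ext => x /=; apply/min_idPl; have := bc_ge_inf (g - f) x.
  by rewrite bcBE; lra.
have [s0|s0] := ltP (bc_sup (g - f)) 0.
  suff -> : bc_min f g = g by [].
  apply: bc_ext => x /=; apply/min_idPr; have := bc_le_sup (g - f) x.
  by rewrite bcBE; lra.
apply: (cW _ _ Wf Wg); rewrite lower_segmentE; exists (- bc_inf (g - f)).
  by rewrite /= in_itv/= mdist_TPclass; lra.
apply/TPclass_eqP; exists (- bc_inf (g - f)); apply: bc_ext => x.
by rewrite !bcE !bcminE !addr_minl !bcE; congr Num.min; lra.
Qed.

Definition least_above T f q :=
  [/\ T (TPclass q), forall x, f x <= q x &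
    forall r, T (TPclass r) -> (forall x, f x <= r x) -> forall x, q x <= r x].

Definition lproj T f : BC X R := xget 0 (least_above T f).

Lemma exists_above T f : T !=set0 ->
  exists q, T (TPclass q) /\ forall x, f x <= q x.
Proof.
move=> [a Ta]; exists (TPrepr a + bc_cst (bc_sup (f - TPrepr a))); split.
  by rewrite TPclassD TPreprK.
by move=> x; have := bc_le_sup (f - TPrepr a) x; rewrite !bcE; lra.
Qed.

                                                                               
                                                                                
Lemma exists_least_above T f : compact T -> lower_tropically_convex T ->
  T !=set0 -> exists q, least_above T f q.
Proof.
move=> coT /lower_tropically_convexP mT T0.
pose D := [set q | T (TPclass q) /\ forall x, f x <= q x].
pose B q := [set TPclass u | u in [set u | D u /\ forall x, u x <= q x]].
have [q0 Dq0] := exists_above f T0.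
have FF : ProperFilter (filter_from D B).
  apply: filter_from_proper; last first.
    by move=> q Dq; exists (TPclass q), q.
  apply: filter_from_filter; first by exists q0.
  move=> q r [Tq fq] [Tr fr]; exists (bc_min q r).
    by split=> [|x /=]; [exact: mT|rewrite le_min fq fr].
  move=> _ [u [Du uqr] <-].
  by split; exists u => //; split=> // x; have := uqr x;
    rewrite /= le_min => /andP[].
have FT : filter_from D B T by exists q0 => // _ [u [[Tu _] _] <-].
have [a [Ta cla]] := coT _ FF FT.
pose s := bc_sup (f - TPrepr a).
exists (TPrepr a + bc_cst s); split.
- by rewrite TPclassD TPreprK.
- by move=> x; have := bc_le_sup (f - TPrepr a) x; rewrite !bcE -/s; lra.
(* Some [u] with [f <= u <= r] has its class within [e] of [a], so [u <= a + c <= u + e] for some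
   [c]. As [f <= u], minimality of [s] gives [s <= c], hence [a + s <= r + e]. *)
move=> r Tr fr x; apply/ler_addgt0Pr => e e0.
have [] := cla (B r) (ball a e).
- by exists r.
- exact: nbhsx_ballx.
move=> _ [[u [[Tu fu] ur] <-]]; rewrite ballEmdist => uae.
have ue : mdist (TPclass u) (TPclass (TPrepr a)) < e.
  by rewrite TPreprK metric_sym.
have [c uc] := mdist_TPclass_repr u (TPrepr a).
have sc : s <= c.
  apply: bc_sup_le => [|y]; first exact: point.
  by have := uc y; have := fu y; rewrite bcBE; lra.
have := uc x; have := ur x.
by rewrite bcDE bccstE; lra.
Qed.

End MinClosed.

(** * The projection [lproj], its gap, and the climb towards it *)

Section Projection.
Context {R : realType} {X : ptopologicalType} {T : set (TP X R)}.
Hypotheses (coT : compact T) (cT : lower_tropically_convex T) (T0 : T !=set0).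
Implicit Types (f g : BC X R) (W : set (TP X R)) (c e k s : R).

Lemma lprojP f : least_above T f (lproj T f).
Proof. exact: xgetPex (exists_least_above f coT cT T0). Qed.

Lemma lproj_in f : T (TPclass (lproj T f)).
Proof. by have [] := lprojP f. Qed.

Lemma lproj_ge f x : f x <= lproj T f x.
Proof. by have [] := lprojP f. Qed.

(** The lift of [T] is stable under shifts, so [lproj T g + k] competes with [lproj T f]. The case
    [k = 0] is monotonicity. *)
Lemma lproj_le f g k : (forall x, f x <= g x + k) ->
  forall x, lproj T f x <= lproj T g x + k.
Proof.
move=> fg x; have [_ _ lf] := lprojP f; have [Tg gg _] := lprojP g.
apply: (lf (lproj T g + bc_cst k)); first by rewrite TPclassD.
by move=> y; have := gg y; have := fg y; rewrite !bcE; lra.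
Qed.

Lemma lproj_id f : T (TPclass f) -> lproj T f = f.
Proof.
move=> Tf; apply: bc_ext => x; have [_ ff lf] := lprojP f.
by apply/eqP; rewrite eq_le ff andbT lf.
Qed.

(** Under the hypotheses on [T] this is the distance from the class of [f] to [T]: leastness forces
    [bc_inf (lproj T f - f) = 0]. *)
Definition gap f : R := bc_sup (lproj T f - f).

Lemma gap_leP f s : gap f <= s <-> forall x, lproj T f x <= f x + s.
Proof.
split=> [fs x|fs]; last first.
  by apply: bc_sup_le => [|x]; [exact: point|have := fs x; rewrite bcBE; lra].
by have := bc_le_sup (lproj T f - f) x; rewrite bcBE -/(gap f); lra.
Qed.

(** With [f <= g + k <= f + d], [lproj T f] is at most [lproj T g + k], hence at most
    [g + gap g + k] and [f + d + gap g]. *)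
Lemma gap_le_mdist f g : gap f <= gap g + mdist (TPclass f) (TPclass g).
Proof.
apply/gap_leP => x; have [k fg] := mdist_TPclass_repr f g.
have /(_ x) pfg : forall x, lproj T f x <= lproj T g x + k.
  by apply: lproj_le => y; have /andP[] := fg y.
have /gap_leP/(_ x) := lexx (gap g); have := fg x.
by move: pfg; lra.
Qed.

Lemma gap_TPclass f g : TPclass f = TPclass g -> gap f = gap g.
Proof.
move=> fg; have := gap_le_mdist f g; have := gap_le_mdist g f.
by rewrite fg mdistxx; lra.
Qed.

(** Monotonicity of [lproj] makes the sublevel sets of [gap] closed under minimum. *)
Lemma gap_min f g s : gap f <= s -> gap g <= s -> gap (bc_min f g) <= s.
Proof.
move=> /gap_leP fs /gap_leP gs; apply/gap_leP => x.
rewrite bcminE addr_minl le_min; apply/andP; split.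
  apply: le_trans (fs x); rewrite -[leRHS]addr0; apply: lproj_le => y.
  by rewrite addr0 bcminE ge_min lexx.
apply: le_trans (gs x); rewrite -[leRHS]addr0; apply: lproj_le => y.
by rewrite addr0 bcminE ge_min lexx orbT.
Qed.

Lemma gap_le0P f : gap f <= 0 <-> T (TPclass f).
Proof.
split=> [/gap_leP f0|Tf]; last by apply/gap_leP => x; rewrite lproj_id// addr0.
suff <- : lproj T f = f by exact: lproj_in.
by apply: bc_ext => x; have := f0 x; have := lproj_ge f x; lra.
Qed.

(** For [c] from 0 to [gap f], its class runs along the lower tropical segment from the class of [f]
    to that of [lproj T f]. *)
Definition climb c f : BC X R := bc_min (f + bc_cst c) (lproj T f).

Lemma climbE c f x : climb c f x = Num.min (f x + c) (lproj T f x).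
Proof. by rewrite /climb bcminE !bcE. Qed.

Lemma climb0 f : climb 0 f = f.
Proof.
by apply: bc_ext => x; rewrite climbE addr0; apply/min_idPl; exact: lproj_ge.
Qed.

Lemma climb_in W c f : lower_tropically_convex W -> T `<=` W ->
  W (TPclass f) -> W (TPclass (climb c f)).
Proof.
move=> /lower_tropically_convexP mW TW Wf; apply: mW; first by rewrite TPclassD.
exact/TW/lproj_in.
Qed.

(** [lproj T f] still lies above the climbed function, so the projection does not rise while the
    function does. *)
Lemma gap_climb c f s : 0 <= s -> gap f <= s + c -> gap (climb c f) <= s.
Proof.
move=> s0 /gap_leP fsc; apply/gap_leP => x.
have : lproj T (climb c f) x <= lproj T f x.
  have [_ _ lf] := lprojP (climb c f); apply: lf; first exact: lproj_in.
  by move=> y; rewrite climbE ge_min lexx orbT.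
move/le_trans; apply; rewrite climbE addr_minl le_min.
by apply/andP; split; [have := fsc x|]; lra.
Qed.

Lemma mdist_climb c c' f g :
  mdist (TPclass (climb c f)) (TPclass (climb c' g)) <=
  2 * `|c - c'| + mdist (TPclass f) (TPclass g).
Proof.
set e := mdist (TPclass f) _; have [k fg] := mdist_TPclass_repr f g.
(* Both [g - f] and [lproj T g - lproj T f] lie in [-k, e - k]; replacing [c] by [c'] widens this
   interval by at most [|c - c'|] on each side. *)
apply: (@mdist_TPclass_le _ _ _ _ (- `|c - c'| - k)) => x.
have /(_ x) h1 : forall x, lproj T f x <= lproj T g x + k.
  by apply: lproj_le => y; have /andP[] := fg y.
have /(_ x) h2 : forall x, lproj T g x <= lproj T f x + (e - k).
  by apply: lproj_le => y; have := fg y; rewrite -/e; lra.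
have := fg x; rewrite -/e => fgx.
have := ler_norm (c - c'); have := ler_norm (c' - c); rewrite (distrC c').
have := normr_ge0 (c - c').
rewrite !climbE; case: (leP (f x + c)); case: (leP (g x + c')); lra.
Qed.

End Projection.

(** * Neighbourhoods in a product *)

Section NearPair.
Context {Y Z : topologicalType}.
Implicit Types (y : Y) (z : Z).

Lemma near_fst y z (P : set Y) :
  (\forall y' \near y, P y') -> \forall yz \near (y, z), P yz.1.
Proof. by move=> Py; apply: (cvg_fst Py). Qed.

Lemma near_snd y z (P : set Z) :
  (\forall z' \near z, P z') -> \forall yz \near (y, z), P yz.2.
Proof. by move=> Pz; apply: (cvg_snd Pz). Qed.

Lemma continuous_map_snd {Z' : topologicalType} (g : Z -> Z') :
  continuous g -> continuous (fun yz : Y * Z => (yz.1, g yz.2)).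
Proof.
move=> cg [y z]; apply: cvg_pair => P nP; first exact: near_fst nP.
exact: near_snd (cg z P nP).
Qed.

End NearPair.

(** * The height to climb, as a function of time and gap *)

Section ClimbTime.
Context {R : realType}.
Implicit Types t D : R.

(* The height to climb from gap D to reach gap 1/t - 1, read as +oo at t = 0
   (where [t^-1] is the junk value 0). *)
Definition climb_height t D : R :=
  if t <= 0 then 0 else Num.max 0 (D - (t^-1 - 1)).

Lemma climb_height0 D : climb_height 0 D = 0.
Proof. by rewrite /climb_height lexx. Qed.

Lemma climb_heightE t D :
  0 < t -> climb_height t D = Num.max 0 (D - (t^-1 - 1)).
Proof. by rewrite /climb_height leNgt => ->. Qed.

(** For [t0 > 0] the formula is continuous. For [t0 <= 0] the height vanishes nearby, because [t^-1]
    exceeds any local bound on the gap when [t] is small and positive. *)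
Lemma climb_height_continuous :
  continuous (fun tD : R * R => climb_height tD.1 tD.2).
Proof.
move=> [t0 D0]; have [t0_le0|t0_gt0] := leP t0 0; last first.
  have tpos : \forall tD \near (t0, D0), 0 < (tD : R * R).1.
    exact: (near_fst D0 (lt_nbhsr t0_gt0)).
  pose G (tD : R * R) : R := tD.2 - (tD.1^-1 - 1).
  have cG : G @ (t0, D0) --> G (t0, D0).
    apply: cvgB; first exact: cvg_snd.
    apply: cvgB; last exact: cvg_cst.
    apply: cvgV; first by rewrite gt_eqF.
    exact: cvg_fst.
  have cM : (fun tD => Num.max 0 (G tD)) @ (t0, D0) --> Num.max 0 (G (t0, D0)).
    by apply: (@continuous_max _ _ (fun=> 0) G) => //; exact: cvg_cst.
  rewrite /continuous_at /= climb_heightE//.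
  apply: cvg_trans cM; apply: near_eq_cvg.
  near=> tD; rewrite climb_heightE//.
  by near: tD; exact: tpos.
rewrite /continuous_at /=.
have -> : climb_height t0 D0 = 0 by rewrite /climb_height t0_le0.
have c0 : (fun=> 0 : R) @ (t0, D0) --> (0 : R) by exact: cvg_cst.
apply: cvg_trans c0; apply: near_eq_cvg.
(* Nearby gaps stay below [|D0| + 1], and [t^-1] must exceed the gap by 1. *)
have M0 : 0 < `|D0| + 2 by rewrite ltr_wpDl.
near=> tD.
rewrite /= /climb_height; case: leP => // t_gt0; apply/esym/max_idPl.
suff : tD.2 + 1 <= tD.1^-1 by lra.
have D_lt : tD.2 < `|D0| + 1.
  near: tD; apply: (@near_snd _ _ t0 D0 [set D | D < `|D0| + 1]).
  by apply: lt_nbhsl; rewrite (le_lt_trans (ler_norm _))// ltrDl.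
have t_lt : tD.1 < (`|D0| + 2)^-1.
  near: tD; apply: (@near_fst _ _ t0 D0 [set t | t < (`|D0| + 2)^-1]).
  by apply: lt_nbhsl; rewrite (le_lt_trans t0_le0)// invr_gt0.
have : `|D0| + 2 <= tD.1^-1.
  by rewrite -[leLHS]invrK lef_pV2 ?posrE ?invr_gt0// ltW.
lra.
Unshelve. all: by end_near. Qed.

End ClimbTime.

(** * The lower retraction *)

Section LowerRetraction.
Context {R : realType} {X : ptopologicalType} {T : set (TP X R)}.
Hypotheses (coT : compact T) (cT : lower_tropically_convex T) (T0 : T !=set0).

Definition lower_retraction (ta : R * TP X R) : TP X R :=
  TPclass (climb (T := T)
    (climb_height ta.1 (gap (T := T) (TPrepr ta.2))) (TPrepr ta.2)).

Lemma near_mdist (a : TP X R) (e : R) :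
  0 < e -> \forall b \near a, mdist a b < e.
Proof. by move=> e0; have := nbhsx_ballx a e e0; rewrite ballEmdist. Qed.

(** [TPrepr] is a mere choice, but [gap] is 1-Lipschitz for the distance between classes. *)
Lemma gap_repr_continuous :
  continuous (fun a : TP X R => gap (T := T) (TPrepr a)).
Proof.
move=> a; apply/(@cvgrPdist_le _ _ _ (nbhs a)) => e e0.
apply: filterS (near_mdist a e0) => b ab.
have := gap_le_mdist coT cT T0 (TPrepr a) (TPrepr b).
have := gap_le_mdist coT cT T0 (TPrepr b) (TPrepr a).
rewrite !TPreprK (metric_sym b) ler_norml; lra.
Qed.

Lemma lower_retraction_continuous : continuous lower_retraction.
Proof.
move=> [t a]; apply/cvg_ballP => e e0.
have cc : (fun ta : R * TP X R =>
    climb_height ta.1 (gap (T := T) (TPrepr ta.2))) @ (t, a)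
    --> climb_height t (gap (T := T) (TPrepr a)).
  have c1 := continuous_map_snd (Y := R) gap_repr_continuous.
  exact: (continuous_comp (c1 (t, a)) (@climb_height_continuous _ _)).
(* [mdist_climb] counts the height difference twice and the distance once, for a total below
   [3 * e / 4]. *)
have e4 : 0 < e / 4 by lra.
near=> ub.
have c_lt : `|climb_height t (gap (T := T) (TPrepr a)) -
    climb_height ub.1 (gap (T := T) (TPrepr ub.2))| < e / 4.
  by near: ub; move/cvgrPdist_lt : cc; apply.
have d_lt : mdist a ub.2 < e / 4.
  near: ub; apply: (@near_snd _ _ t a [set b | mdist a b < e / 4]).
  exact: near_mdist.
rewrite ballEmdist /lower_retraction /=.
apply: le_lt_trans (mdist_climb coT cT T0 _ _ _ _) _.
rewrite !TPreprK; lra.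
Unshelve. all: by end_near. Qed.

Lemma lower_retraction0 a : lower_retraction (0, a) = a.
Proof. by rewrite /lower_retraction /= climb_height0 climb0// TPreprK. Qed.

Lemma lower_retraction_id t a : 0 < t -> gap (T := T) (TPrepr a) <= t^-1 - 1 ->
  lower_retraction (t, a) = a.
Proof.
move=> t0 at_; rewrite /lower_retraction /= climb_heightE//.
have /max_idPl -> : gap (T := T) (TPrepr a) - (t^-1 - 1) <= 0 by lra.
by rewrite climb0// TPreprK.
Qed.

Lemma gap_lower_retraction t a : 0 < t <= 1 ->
  gap (T := T) (TPrepr (lower_retraction (t, a))) <= t^-1 - 1.
Proof.
move=> /andP[t0 t1]; rewrite /lower_retraction /=.
rewrite (gap_TPclass coT cT T0 (TPreprK _)) climb_heightE//.
apply: gap_climb => //; first by rewrite subr_ge0 invf_ge1.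
by rewrite -lerBlDl le_max lexx orbT.
Qed.

Lemma lower_retraction_in (W : set (TP X R)) t a :
  lower_tropically_convex W -> T `<=` W -> W a -> W (lower_retraction (t, a)).
Proof. by move=> cW TW Wa; apply: climb_in => //; rewrite TPreprK. Qed.

(** The map at time [t] lands in this sublevel set and fixes it pointwise. *)
Lemma lower_retraction_image (W : set (TP X R)) t :
  lower_tropically_convex W -> T `<=` W -> 0 < t <= 1 ->
  [set lower_retraction (t, a) | a in W] =
  [set a | W a /\ gap (T := T) (TPrepr a) <= t^-1 - 1].
Proof.
move=> cW TW t01; apply/seteqP; split=> [_ [a Wa <-]|a [Wa ga]].
  by split; [exact: lower_retraction_in|exact: gap_lower_retraction].
by exists a => //; apply: lower_retraction_id => //; case/andP: t01.
Qed.

Lemma lower_retractionP (W : set (TP X R)) :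
  lower_tropically_convex W -> T `<=` W ->
  lower_tropical_retraction W T lower_retraction.
Proof.
move=> cW TW.
have gapT a : gap (T := T) (TPrepr a) <= 0 <-> T a.
  by rewrite -{2}(TPreprK a); exact: gap_le0P.
split; first split.
- exact/continuous_subspaceT/lower_retraction_continuous.
- by move=> t a _ Wa; exact: lower_retraction_in.
- by move=> a _; exact: lower_retraction0.
- rewrite lower_retraction_image ?ltr01 ?lexx// invr1 subrr.
  apply/seteqP; split=> [a [_ /gapT]//|a Ta]; split; first exact: TW.
  exact/gapT.
- move=> t a; rewrite in_itv/= => /andP[t0 t1] Ta.
  have [->|tn0] := eqVneq t 0; first exact: lower_retraction0.
  have tp : 0 < t by rewrite lt_neqAle eq_sym tn0.
  apply: lower_retraction_id => //; move/gapT : Ta => /le_trans; apply.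
  by rewrite subr_ge0 invf_ge1.
move=> t; rewrite in_itv/= => /andP[t0 t1].
(* Time 0 is apart: with [0^-1 = 0] the level [t^-1 - 1] would be -1 instead of infinite. *)
have [->|tn0] := eqVneq t 0.
  suff -> : [set lower_retraction (0, x) | x in W] = W by [].
  apply/seteqP; split=> [_ [a Wa <-]|a Wa]; first by rewrite lower_retraction0.
  by exists a => //; exact: lower_retraction0.
rewrite lower_retraction_image//; last by rewrite t1 lt_neqAle eq_sym tn0 t0.
apply/lower_tropically_convexP => f g [Wf gf] [Wg gg]; split.
  by move/lower_tropically_convexP : cW; apply.
rewrite (gap_TPclass coT cT T0 (TPreprK _)).
apply: gap_min => //.
  by rewrite -(gap_TPclass coT cT T0 (TPreprK _)).
by rewrite -(gap_TPclass coT cT T0 (TPreprK _)).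
Qed.

End LowerRetraction.

(** * Negation exchanges the lower and upper structures *)

Section Duality.
Context {R : realType} {X : ptopologicalType}.
Implicit Types (W T : set (TP X R)) (f g : BC X R) (a b : TP X R).

Lemma TPclassN f : TPclass (- f) = - TPclass f.
Proof. by rewrite /TPclass -pi_oppr. Qed.

Lemma mdist_oppr a b : mdist (- a) (- b) = mdist a b.
Proof.
rewrite -(TPreprK a) -(TPreprK b) -!TPclassN metric_sym !mdist_TPclass.
suff -> : - TPrepr a - - TPrepr b = TPrepr b - TPrepr a by [].
by rewrite opprK addrC.
Qed.

Lemma oppr_TP_continuous : continuous (-%R : TP X R -> TP X R).
Proof.
move=> a; apply/(@cvg_ballP _ _ _ (nbhs a)) => e e0.
apply: filterS (near_mdist a e0) => b ab.
by rewrite ballEmdist; have : mdist (- a) (- b) < e by rewrite mdist_oppr.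
Qed.

Lemma bc_supN f : bc_sup (- f) = - bc_inf f.
Proof.
apply/eqP; rewrite eq_le; apply/andP; split.
  by apply: bc_sup_le => [|x]; [exact: point|rewrite bcNE lerN2 bc_ge_inf].
rewrite lerNl; apply: bc_inf_ge => [|x]; first exact: point.
by rewrite lerNl -bcNE bc_le_sup.
Qed.

(** Negation turns minimum into maximum and infimum into supremum; being an isometry, it keeps the
    range of parameters. *)
Lemma upper_segment_oppr a b :
  upper_segment (- a) (- b) = -%R @` lower_segment a b.
Proof.
rewrite -(TPreprK a) -(TPreprK b) -!TPclassN.
move: (TPrepr a) (TPrepr b) => f g.
rewrite upper_segmentE lower_segmentE !TPclassN mdist_oppr image_comp.
apply: eq_imagel => t _ /=; rewrite -TPclassN; congr TPclass.
have -> : - g - - f = - (g - f) by rewrite opprB opprK addrC.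
apply: bc_ext => x.
rewrite bcDE bcmaxE [RHS]bcNE [in RHS]bcDE bcminE [RHS]opprD oppr_min.
congr (Num.max _ _ + _); rewrite /bc_upper bc_supN !bcE; lra.
Qed.

Lemma upper_tropically_convex_oppr W :
  upper_tropically_convex W <-> lower_tropically_convex (-%R @^-1` W).
Proof.
split=> cW a b Wa Wb x.
  move=> abx; apply: (cW _ _ Wa Wb); rewrite upper_segment_oppr.
  by exists x.
rewrite -(opprK a) -(opprK b) upper_segment_oppr => -[y aby <-].
by apply: (cW (- a) (- b)) aby; rewrite /preimage /= opprK.
Qed.

End Duality.

Theorem theorem5p2 (R : realType) (X : ptopologicalType)
    (mu : {measure set (borelType X) -> \bar R})
    (hX : locally_compact [set: X]) (hX' : hausdorff_space X)
    (mu_gt0 : (0 < mu setT)%E) (mu_fin : (mu setT < +oo)%E)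
    (mu_ae : forall f : BC X R,
      (exists c : R, {ae mu, forall x, f x = c}) -> TPclass f = 0) :
  (forall W T : set (TP X R),
     lower_tropically_convex W ->
     compact T -> lower_tropically_convex T -> T `<=` W -> T !=set0 ->
     exists h : R * TP X R -> TP X R, lower_tropical_retraction W T h)
  /\
  (forall W T : set (TP X R),
     upper_tropically_convex W ->
     compact T -> upper_tropically_convex T -> T `<=` W -> T !=set0 ->
     exists h : R * TP X R -> TP X R, upper_tropical_retraction W T h).
Proof.
split=> W T cW coT cT TW T0.
  by exists (lower_retraction (T := T)); exact: lower_retractionP.
pose N (A : set (TP X R)) := -%R @^-1` A.
(* Convexity transfers through the preimage, compactness through the image. *)
have NE A : N A = -%R @` A.
  apply/seteqP; split=> [a Aa|_ [a Aa <-]]; last first.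
    by rewrite /N /preimage /= opprK.
  by exists (- a) => //; rewrite opprK.
have coN : compact (N T).
  rewrite NE; apply: continuous_compact => //.
  exact/continuous_subspaceT/oppr_TP_continuous.
have N0 : N T !=set0 by rewrite NE; case: T0 => a Ta; exists (- a), a.
have NTW : N T `<=` N W by move=> a; exact: TW.
move/upper_tropically_convex_oppr : cW => cNW.
move/upper_tropically_convex_oppr : cT => cNT.
have [[_ hW h0 h1 hid] himg] := lower_retractionP coN cNT N0 cNW NTW.
have hcont := lower_retraction_continuous coN cNT N0.
set h := lower_retraction in hW h0 h1 hid himg hcont.
exists (fun ta => - h (ta.1, - ta.2)); split; first split.
- apply: continuous_subspaceT => -[t a].
  have c1 := continuous_map_snd (Y := R) (@oppr_TP_continuous R X).
  have c2 := continuous_comp (c1 (t, a)) (hcont _).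
  exact: (continuous_comp c2 (@oppr_TP_continuous R X _)).
- move=> t a t01 Wa; apply: hW => //.
  by rewrite /N /preimage /= opprK.
- by move=> a Wa; rewrite /= h0 ?opprK// /N /preimage /= opprK.
- apply/seteqP; split=> [_ [a Wa <-]|a Ta].
    suff : N T (h (1, - a)) by [].
    by rewrite -h1; exists (- a) => //; rewrite /N /preimage /= opprK.
  exists a; first exact: TW.
  rewrite /= hid ?opprK// ?in_itv/= ?ler01 ?lexx//.
  by rewrite /N /preimage /= opprK.
- by move=> t a t01 Ta; rewrite /= hid ?opprK// /N /preimage /= opprK.
move=> t t01; apply/upper_tropically_convex_oppr.
(* Undoing the outer negation leaves the lower retraction of [N W], whose image is already known to
   be convex. *)
suff -> : -%R @^-1` [set - h (t, - a) | a in W] = [set h (t, a) | a in N W].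
  exact: himg.
apply/seteqP; split=> [a [b Wb /oppr_inj <-]|_ [a Wa <-]].
  by exists (- b) => //; rewrite /N /preimage /= opprK.
by exists (- a) => //=; rewrite opprK.
Qed.
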